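(* Let $k$ be a field of characteristic zero, and let $f,g\in k[x]$ be nonconstant. Let $C_{f,g}=(f(X)-g(Y)=0)_{\mathrm{red}}\subset\mathbb A^2_k$. There is a bijection between: (i) geometrically integral irreducible components $C$ of $C_{f,g}$, defined over $k$, whose affine normalization is isomorphic to $\mathbb A^1_k$; (ii) primitive polynomial sources $(A,B)$ for $(f,g)$ over $k$, up to affine change of the parameter. Under this correspondence, if $t$ is a coordinate on the affine normalization $\mathbb A^1_k$ of $C$, then $$X=A(t),\qquad Y=B(t),$$ $$d_X(C)=\deg A,\qquad d_Y(C)=\deg B,$$ and $$\deg f\cdot\deg A=\deg g\cdot\deg B.$$ Moreover, $C$ is a graph component if and only if $B\in k[A]$.
   Context: $C_{f,g}$ is the reduced affine plane curve defined by $f(X)=g(Y)$. A primitive polynomial source for $(f,g)$ over $k$ is a pair of nonconstant polynomials $(A,B)\in k[t]^2$ such that $f(A(t))=g(B(t))$ and $k(A(t),B(t))=k(t)$. Two primitive sources are identified if they differ by an affine change of parameter $t\mapsto at+b$ with $a\in k^*$, $b\in k$. For a geometrically integral component $C$ of $C_{f,g}$, let $\widetilde C$ be its smooth projective normalization; $d_X(C)=\deg(X:\widetilde C\to\mathbb P^1)$ and $d_Y(C)=\deg(Y:\widetilde C\to\mathbb P^1)$ are the degrees of the maps given by the coordinate functions. A graph component is a component of the form $Y=h(X)$ with $h\in k[X]$ and $f=g\circ h$. *)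

(* Defs.v *)
From HB Require Import structures.
From mathcomp Require Import all_boot all_order all_algebra.
From mathcomp Require Import generic_quotient ring_quotient fraction.
From mathcomp Require Import boolp classical_sets functions.

Set Implicit Arguments.
Unset Strict Implicit.
Unset Printing Implicit Defensive.

Import GRing.Theory.

Local Open Scope ring_scope.
Local Open Scope quotient_scope.
Local Open Scope classical_set_scope.

Local Notation "x %:F" := (tofrac x).

Section Generalities.

Definition natdeg (R : nzRingType) (p : {poly R}) : nat := (size p).-1.

Definition subfield (L : fieldType) (S : set L) : Prop :=
  GRing.divring_closed (mem S).

Definition generated_subfield (L : fieldType) (G : set L) : set L :=
  smallest (@subfield L) G.

Definition basis_over (L : fieldType) (S : set L) (n : nat) (v : 'I_n -> L) :
    Prop :=
  forall z : L, exists! c : {ffun 'I_n -> L},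
    (forall i, S (c i)) /\ z = \sum_i c i * v i.

(* The degree [L : S] of L over a subfield S, with value 0 when infinite. *)
Definition ext_degree (L : fieldType) (S : set L) : nat :=
  xget 0%N [set n | exists v : 'I_n -> L, basis_over S v].

End Generalities.

(* The ring k[X, Y], written k[X][Y]: the outer variable 'X is Y and the
   inner one, 'X%:P, is X. *)
Notation bipoly k := {poly {poly k}}.

Section Plane.

Variable k : fieldType.

Definition scalar2 (c : k) : bipoly k := c%:P%:P.
Definition varX : bipoly k := 'X%:P.
Definition varY : bipoly k := 'X.

Definition inX (h : {poly k}) : bipoly k := h%:P.
Definition inY (h : {poly k}) : bipoly k := map_poly polyC h.

(* The radical of (f(X) - g(Y)), i.e. the ideal of the reduced curve. *)
Definition curve_ideal (f g : {poly k}) : set (bipoly k) :=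
  [set p | exists n : nat, exists q : bipoly k, p ^+ n = q * (inX f - inY g)].

End Plane.

Section CoordinateRing.

Variables (k : fieldType) (P : prime_idealr (bipoly k)).

Definition coord_ring := {ideal_quot P}.
HB.instance Definition _ := GRing.ComNzRing.on coord_ring.

Definition coord_unit : {pred coord_ring} :=
  fun x => `[< exists y, y * x = 1 >].
Definition coord_inv (x : coord_ring) : coord_ring :=
  xget x [set y | y * x = 1].

Lemma coord_mulVx : {in coord_unit, left_inverse 1 coord_inv *%R}.
Proof.
move=> x /asboolP yx.
exact: (xgetPex (P := [set y | y * x = 1]) x yx).
Qed.

Lemma coord_unitP (x y : coord_ring) : y * x = 1 -> x \in coord_unit.
Proof. by move=> yx; apply/asboolP; exists y. Qed.

Lemma coord_inv0id : {in [predC coord_unit], coord_inv =1 id}.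
Proof.
move=> x /negP xNU; rewrite /coord_inv xgetPN // => y yx.
by apply: xNU; exact: coord_unitP yx.
Qed.

HB.instance Definition _ := GRing.ComNzRing_hasMulInverse.Build coord_ring
  coord_mulVx coord_unitP coord_inv0id.
HB.instance Definition _ := GRing.ComUnitRing_isIntegral.Build coord_ring
  (@Quotient.rquot_IdomainAxiom _ P).

Local Notation function_field := {fraction coord_ring}.

Definition curve_fun (p : bipoly k) : function_field :=
  (\pi_coord_ring p : coord_ring)%:F.

Definition const (c : k) : function_field := curve_fun (scalar2 c).
Definition coordX : function_field := curve_fun (varX k).
Definition coordY : function_field := curve_fun (varY k).

Definition eval_ff (p : {poly k}) (t : function_field) : function_field :=
  (map_poly const p).[t].

Definition normalization : set function_field :=
  [set z | integralOver (@tofrac coord_ring) z].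

(* phi is an isomorphism of k-algebras from k[t] onto the coordinate ring of
   the affine normalization. *)
Definition line_iso (phi : {rmorphism {poly k} -> function_field}) : Prop :=
  [/\ forall c : k, phi c%:P = const c,
      injective phi
    & range phi = normalization].

Definition coordinate (t : function_field) : Prop :=
  exists2 phi : {rmorphism {poly k} -> function_field},
    line_iso phi & phi 'X = t.

Definition normalization_is_line : Prop := exists phi, line_iso phi.

(* The smooth projective normalization of C has function field k(C); the
   degree of its morphism to P^1 given by u in k(C) is [k(C) : k(u)], or 0 if u
   is constant. *)
Definition map_degree (u : function_field) : nat :=
  ext_degree (generated_subfield (range const `|` [set u])).

Definition dX : nat := map_degree coordX.
Definition dY : nat := map_degree coordY.

End CoordinateRing.

Arguments curve_fun {k} P p.
Arguments line_iso {k} P phi.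
Arguments coordinate {k} P t.
Arguments map_degree {k} P u.


Section Components.

Variable k : fieldType.
Implicit Types (P Q : prime_idealr (bipoly k)) (f g : {poly k}).

(* Irreducible components are the minimal primes over the ideal of the curve. *)
Definition component f g P : Prop :=
  curve_ideal f g `<=` [set` P] /\
  forall Q, curve_ideal f g `<=` [set` Q] ->
    [set` Q] `<=` [set` P] -> [set` Q] = [set` P].

Definition prime_ideal (R : comNzRingType) (I : set R) : Prop :=
  idealr_closed (mem I) /\ prime_idealr_closed (mem I).

(* The extension of P to K[X, Y]. *)
Definition extended_ideal P (K : fieldType) (iota : {rmorphism k -> K}) :
    set (bipoly K) :=
  [set q | exists n, exists (a : 'I_n -> bipoly K) (p : 'I_n -> bipoly k),
     (forall i, p i \in P) /\
     q = \sum_i a i * map_poly (map_poly iota) (p i)].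

(* k[X, Y]/P tensored with K is K[X, Y]/PK[X, Y]. *)
Definition geometrically_integral P : Prop :=
  forall (K : fieldType) (iota : {rmorphism k -> K}),
    prime_ideal (extended_ideal P iota).

Definition line_components f g : set (prime_idealr (bipoly k)) :=
  [set P | [/\ component f g P, geometrically_integral P
             & normalization_is_line P]].

Definition graph_component f g P : Prop :=
  exists2 h : {poly k}, f = g \Po h
    & [set` P] = range (fun q => q * (varY k - inX h)).

Definition primitive_source f g (s : {poly k} * {poly k}) : Prop :=
  [/\ (0 < natdeg s.1)%N, (0 < natdeg s.2)%N, f \Po s.1 = g \Po s.2
    & generated_subfield (range (fun c : k => c%:P%:F) `|` [set s.1%:F; s.2%:F]) = setT].

Definition affine_class (s : {poly k} * {poly k}) : set ({poly k} * {poly k}) :=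
  [set s' | exists a b : k, a != 0 /\
     s' = (s.1 \Po (a *: 'X + b%:P), s.2 \Po (a *: 'X + b%:P))].

Definition source_classes f g : set (set ({poly k} * {poly k})) :=
  @affine_class @` primitive_source f g.

End Components.

(* Main.v *)
(**
Evaluation at a pair s = (A, B) of polynomials is a ring morphism
ev s : k[X, Y] -> k[t], p |-> p(A(t), B(t)).  The component attached to s is the
kernel P of ev s; a source attached to P is a primitive s whose kernel is P.

If phi identifies k[t] with the affine normalization of the component P, then X
and Y are integral, so X = phi A and Y = phi B, the kernel of ev (A, B) is P, and
writing phi(t) as a quotient of elements of k[X, Y]/P shows k(A, B) = k(t).
Conversely, let (A, B) be primitive with kernel P and write t = U(A, B)/V(A, B).
Sending t to U/V in the function field of P embeds k[t] over k[X, Y]/P; t is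
integral because A(t) = X, and k[t] is integrally closed, so the image is the
normalization.  Two sources of the same P hence differ by an automorphism of the
k-algebra k[t], i.e. by an affine change of parameter.

The kernel P is a minimal prime over f(X) - g(Y): modulo a smaller prime Q
containing f(X) - g(Y), every function is integral over k[X], so an element of
P outside Q would divide a nonzero element c(X) modulo Q, giving c(A) = 0.  It is
geometrically integral because the kernel of ev s over an extension K is spanned
by the kernel over k (expand coefficients on a k-basis of their span).  The
degrees are computed by the basis 1, t, ..., t^(n-1) of k(t) over k(A), n = deg A.
*)
Require Import Defs.
From HB Require Import structures.
From mathcomp Require Import all_boot all_order all_algebra.
From mathcomp Require Import generic_quotient ring_quotient fraction.
From mathcomp Require Import boolp classical_sets functions.

Set Implicit Arguments.
Unset Strict Implicit.
Unset Printing Implicit Defensive.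

Import GRing.Theory.
Local Open Scope ring_scope.
Local Open Scope classical_set_scope.

(** * Subfields and fields of fractions *)

Section Subfields.
Implicit Type L : fieldType.

Section SubfieldTheory.
Variables (L : fieldType) (S : set L) (S_field : subfield S).

Lemma subfield1 : S 1.
Proof. by case: S_field => + _ _; rewrite inE. Qed.

Lemma subfieldB x y : S x -> S y -> S (x - y).
Proof. by case: S_field => _ + _; move=> /(_ x y); rewrite !inE. Qed.

Lemma subfield_div x y : S x -> S y -> S (x / y).
Proof. by case: S_field => _ _; move=> /(_ x y); rewrite !inE. Qed.

Lemma subfieldD x y : S x -> S y -> S (x + y).
Proof.
move=> Sx Sy; rewrite -[y]opprK; apply: subfieldB => //.
rewrite -[- y]add0r; apply: subfieldB => //.
by rewrite -(subrr 1); apply: subfieldB subfield1 subfield1.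
Qed.

Lemma subfieldM x y : S x -> S y -> S (x * y).
Proof.
move=> Sx Sy; rewrite -[y]invrK; apply: subfield_div => //.
by rewrite -[y^-1]mul1r; apply: subfield_div => //; apply: subfield1.
Qed.

End SubfieldTheory.

Lemma subfield_generated L (G : set L) : subfield (generated_subfield G).
Proof.
split=> [|x y|x y]; rewrite !inE.
- by move=> S [/subfield1].
- by move=> Gx Gy S CS; apply: (subfieldB CS.1); [apply: Gx | apply: Gy].
- by move=> Gx Gy S CS; apply: (subfield_div CS.1); [apply: Gx | apply: Gy].
Qed.

(** For a ring morphism [h], this is the field of fractions of its image inside [L]. *)
Definition frac_range (R : nzRingType) L (h : R -> L) : set L :=
  [set z | exists a b, h b != 0 /\ z = h a / h b].

Lemma subfield_frac_range (R : nzRingType) L (h : {rmorphism R -> L}) :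
  subfield (frac_range h).
Proof.
split=> [|x y|x y]; rewrite !inE.
- by exists 1, 1; rewrite rmorph1 divr1 oner_eq0.
- move=> [a [b [hb ->]]] [c [d [hd ->]]].
  exists (a * d - c * b), (b * d).
  by rewrite rmorphB !rmorphM mulf_neq0 // -[- (_ / _)]mulNr addf_div // mulNr.
- move=> [a [b [hb ->]]] [c [d [hd ->]]].
  have [->|hc] := eqVneq (h c) 0.
    by exists 0, 1; rewrite rmorph0 rmorph1 oner_eq0 mul0r invr0 mulr0 mul0r.
  exists (a * d), (b * c).
  by rewrite !rmorphM mulf_neq0 // invf_div mulf_div.
Qed.

Lemma range_sub_frac_range (R : nzRingType) L (h : {rmorphism R -> L}) a :
  frac_range h (h a).
Proof. by exists a, 1; rewrite rmorph1 oner_eq0 divr1. Qed.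

Lemma fractionE (R : idomainType) (z : {fraction R}) :
  exists a b, b != 0 /\ z = tofrac a / tofrac b.
Proof.
elim/quotW: z => x; exists (frac x).1, (frac x).2.
have x2_neq0 : (frac x).2 != 0 by case: x.
split=> //; apply: (canRL (mulfK _)); first by rewrite tofrac_eq0.
apply/eqP; rewrite !piE /equivf /= !numden_Ratio ?oner_eq0 ?mulf_neq0 ?oner_eq0 //.
by rewrite !mulr1 mulrC.
Qed.

End Subfields.

(** * Evaluation of k[X, Y] at a pair of polynomials *)

Section Evaluation.
Variable k : fieldType.
Implicit Types (s : {poly k} * {poly k}) (A B : {poly k}).

Definition ev s : bipoly k -> {poly k} :=
  horner_eval s.2 \o map_poly (comp_poly s.1).
HB.instance Definition _ s := GRing.RMorphism.on (ev s).

Lemma evE s p : ev s p = (map_poly (comp_poly s.1) p).[s.2].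
Proof. by []. Qed.

Lemma evB s : {morph ev s : p q / p - q}.
Proof. exact: rmorphB. Qed.

Lemma evD s : {morph ev s : p q / p + q}.
Proof. exact: rmorphD. Qed.

Lemma evM s : {morph ev s : p q / p * q}.
Proof. exact: rmorphM. Qed.

Lemma ev0 s : ev s 0 = 0.
Proof. exact: rmorph0. Qed.

Lemma ev1 s : ev s 1 = 1.
Proof. exact: rmorph1. Qed.

Lemma ev_inX s h : ev s (inX h) = h \Po s.1.
Proof. by rewrite evE map_polyC hornerC. Qed.

Lemma ev_inY s h : ev s (inY h) = h \Po s.2.
Proof.
rewrite evE /inY -map_poly_comp; congr (_.[_]).
by apply: eq_map_poly => c /=; rewrite comp_polyC.
Qed.

Lemma ev_varY s : ev s (varY k) = s.2.
Proof. by rewrite evE map_polyX hornerX. Qed.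

Lemma ev_varX s : ev s (varX k) = s.1.
Proof. exact: etrans (ev_inX s 'X) (comp_polyX _). Qed.

Lemma ev_scalar2 s c : ev s (scalar2 c) = c%:P.
Proof. exact: etrans (ev_inX s c%:P) (comp_polyC _ _). Qed.

Lemma bipoly_morphE (R : comNzRingType) (h1 h2 : {rmorphism bipoly k -> R}) :
    (forall c, h1 (scalar2 c) = h2 (scalar2 c)) ->
    h1 (varX k) = h2 (varX k) -> h1 (varY k) = h2 (varY k) ->
  h1 =1 h2.
Proof.
move=> hc hX hY; elim/poly_ind => [|p q IHp]; first by rewrite !rmorph0.
rewrite !rmorphD !rmorphM IHp -/(varY k) hY; congr (_ + _).
elim/poly_ind: q => [|q c IHq]; first by rewrite !rmorph0.
by rewrite polyCD polyCM !rmorphD !rmorphM IHq -/(varX k) hX -/(scalar2 c) hc.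
Qed.

Lemma ev_comp s T p : ev (s.1 \Po T, s.2 \Po T) p = ev s p \Po T.
Proof.
apply: (@bipoly_morphE _ (ev _) (comp_poly T \o ev s)) => [c||] /=.
- by rewrite !ev_scalar2 comp_polyC.
- by rewrite !ev_varX.
- by rewrite !ev_varY.
Qed.

(** Comparison on the generators shows that [ev s p] equals its value at 0. This later excludes
    constant parametrizations. *)
Lemma ev_const s : (natdeg s.1 = 0)%N -> (natdeg s.2 = 0)%N ->
  forall p, (size (ev s p) <= 1)%N.
Proof.
have szC (q : {poly k}) : natdeg q = 0%N -> q = (q`_0)%:P.
  by move=> q0; apply: size1_polyC; move: q0; rewrite /natdeg; case: size => [|[]].
move=> /szC E1 /szC E2 p.
have -> : ev s p = (ev s p).[0]%:P; last by rewrite size_polyC leq_b1.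
apply: (@bipoly_morphE _ (ev s) (polyC \o horner_eval 0 \o ev s)) => [c||] /=.
- by rewrite !ev_scalar2 horner_evalE hornerC.
- by rewrite !ev_varX horner_evalE E1 hornerC.
- by rewrite !ev_varY horner_evalE E2 hornerC.
Qed.

Lemma ev_curve f g s : ev s (inX f - inY g) = (f \Po s.1) - (g \Po s.2).
Proof. by rewrite evB ev_inX ev_inY. Qed.

Lemma natdeg_comp (p q : {poly k}) : natdeg (p \Po q) = (natdeg p * natdeg q)%N.
Proof. by rewrite /natdeg size_comp_poly. Qed.

Lemma comp_nonconstant_eq0 (p q : {poly k}) :
  (0 < natdeg q)%N -> (p \Po q == 0) = (p == 0).
Proof.
by move=> q_nc; apply: comp_poly_eq0; move: q_nc; rewrite /natdeg; case: size => [|[]].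
Qed.

(** Replaces the condition k(A, B) = k(t) by an explicit quotient equal to t. Quotients of values of
    [ev s] form a subfield containing the generators, hence t; conversely, a subfield containing the
    constants and t contains every fraction. *)
Lemma primitive_generated s :
  generated_subfield (range (fun c : k => tofrac c%:P)
      `|` [set tofrac s.1; tofrac s.2]) = setT <->
  exists U V, ev s V != 0 /\ 'X * ev s V = ev s U.
Proof.
set G := _ `|` _; pose h : {rmorphism bipoly k -> {fraction {poly k}}} :=
  (@tofrac {poly k}) \o ev s.
split=> [GT|[U [V [V0 UV]]]].
  have : frac_range h (tofrac 'X).
    have: setT (tofrac ('X : {poly k})) by []. 
    rewrite -GT; apply: smallest_sub; first exact: subfield_frac_range.
    move=> z [[c _ <-]|[]->].
    - by rewrite -(ev_scalar2 s) -[tofrac _]/(h _); apply: range_sub_frac_range.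
    - by rewrite -(ev_varX s) -[tofrac _]/(h _); apply: range_sub_frac_range.
    - by rewrite -(ev_varY s) -[tofrac _]/(h _); apply: range_sub_frac_range.
  move=> [U [V [/= V0 XUV]]]; exists U, V; split.
    by move: V0; rewrite tofrac_eq0.
  by apply/eqP; rewrite -tofrac_eq tofracM XUV divfK.
apply/seteqP; split=> // z _ S [S_field GS].
have Sc c : S (tofrac c%:P) by apply: GS; left; exists c.
have Sh p : S (h p).
  elim/poly_ind: p => [|p q IH].
    by rewrite rmorph0 -(subrr 1); apply: subfieldB => //; apply: subfield1.
  rewrite rmorphD rmorphM; apply: subfieldD => //.
    apply: subfieldM => //; rewrite -/(varY k) /= ev_varY.
    by apply: GS; right; right.
  elim/poly_ind: q => [|q c IHq].
    by rewrite rmorph0 -(subrr 1); apply: subfieldB => //; apply: subfield1.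
  rewrite polyCD polyCM rmorphD rmorphM; apply: subfieldD => //.
    apply: subfieldM => //; rewrite -/(varX k) /= ev_varX.
    by apply: GS; right; left.
  by rewrite -/(scalar2 c) /= ev_scalar2.
have SX : S (tofrac 'X).
  suff -> : tofrac 'X = h U / h V by apply: subfield_div.
  by rewrite /= -UV tofracM mulfK // tofrac_eq0.
have Sp (p : {poly k}) : S (tofrac p).
  elim/poly_ind: p => [|p c IH]; first by rewrite -polyC0.
  by rewrite tofracD tofracM; apply: subfieldD => //; apply: subfieldM.
have [a [b [_ ->]]] := fractionE z.
exact: subfield_div.
Qed.

End Evaluation.

(** * Integral elements and integral closedness of k[t] *)

Section Integrality.

(** The leading coefficient of [g] is invertible in [k], so dividing g(T) - r by it gives a monic
    equation for [y]. *)
Lemma integral_of_poly_value (k : fieldType) (R D : comNzRingType)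
    (iota : {rmorphism k -> R}) (h : {rmorphism R -> D}) (g : {poly k})
    (r : R) (y : D) :
    (0 < natdeg g)%N -> (map_poly (h \o iota) g).[y] = h r ->
  integralOver h y.
Proof.
move=> g_nc gy; pose c := lead_coef g; pose G := map_poly iota (c^-1 *: g).
have c0 : c != 0.
  by rewrite lead_coef_eq0 -size_poly_gt0; apply: leq_trans g_nc (leq_pred _).
exists (G - (iota c^-1 * r)%:P).
  rewrite monicE lead_coefDl; last first.
    rewrite size_polyN size_map_poly size_scale ?invr_eq0 //.
    apply: leq_ltn_trans (size_polyC_leq1 _) _.
    by move: g_nc; rewrite /natdeg; case: size => [|[]].
  by rewrite lead_coef_map lead_coefZ mulVf // rmorph1.
rewrite rmorphB /= map_polyC /= -map_poly_comp rootE hornerD hornerN hornerC.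
by rewrite linearZ /= hornerZ gy rmorphM subrr.
Qed.

Lemma integral_poly_value (k : fieldType) (R D : comNzRingType)
    (iota : {rmorphism k -> R}) (h : {rmorphism R -> D}) (p : {poly k})
    (y : D) :
  integralOver h y -> integralOver h (map_poly (h \o iota) p).[y].
Proof.
apply: integral_horner; apply/integral_poly => i.
by rewrite coef_map; apply: integral_id.
Qed.

(* c is the constant coefficient of an integral equation of minimal degree. *)
Lemma integral_dvd (R : comNzRingType) (D : idomainType)
    (h : {rmorphism R -> D}) (x : D) :
    x != 0 -> integralOver h x ->
  exists c y, c != 0 /\ x * y = h c.
Proof.
move=> x0 [p /monic_neq0 p0 px].
elim/poly_ind: p p0 px => [|p c IH]; first by rewrite eqxx.
have [->|c0] := eqVneq c 0.
  rewrite addr0 rmorphM /= map_polyX rootM rootX (negPf x0) orbF => pX0.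
  by apply: IH; apply: contraNneq pX0 => ->; rewrite mul0r.
move=> _; rewrite rmorphD rmorphM /= map_polyX map_polyC rootE !hornerE /=.
move=> /eqP pxc; exists c, (- (map_poly h p).[x]); split=> //.
by rewrite mulrN mulrC; apply/eqP; rewrite eq_sym -addr_eq0 addrC pxc.
Qed.

Lemma integral_sub_range (R1 R2 K : comNzRingType) (h1 : {rmorphism R1 -> K})
    (h2 : {rmorphism R2 -> K}) (z : K) :
  (forall r, exists r', h1 r = h2 r') -> integralOver h1 z -> integralOver h2 z.
Proof.
move=> h12 [p p_monic pz0]; apply: integral_root_monic pz0 _.
  exact: monic_map.
apply/integral_poly => i; rewrite coef_map /=.
by have [r ->] := h12 p`_i; apply: integral_id.
Qed.

(** The rational root argument: in lowest terms a / b, the integral equation forces [b] to divide a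
    power of [a], so [b] is a constant. *)
Lemma poly_integrally_closed (k L : fieldType) (phi : {rmorphism {poly k} -> L})
    (phi_inj : injective phi) (z : L) :
  frac_range phi z -> integralOver phi z -> exists p, z = phi p.
Proof.
move=> [a0 [b0 [phib0 ->]]].
have b0_neq0 : b0 != 0 by apply: contraNneq phib0 => ->; rewrite rmorph0.
pose d := gcdp a0 b0; have d0 : d != 0 by rewrite gcdp_eq0 (negPf b0_neq0) andbF.
pose a := a0 %/ d; pose b := b0 %/ d.
have a0E : a0 = a * d by rewrite divpK // dvdp_gcdl.
have b0E : b0 = b * d by rewrite divpK // dvdp_gcdr.
have ab : coprimep a b by apply: coprimep_div_gcd; rewrite b0_neq0 orbT.
have phid : phi d != 0 by rewrite -(rmorph0 phi) (inj_eq phi_inj).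
have phib : phi b != 0.
  by apply: contraNneq phib0; rewrite b0E rmorphM => ->; rewrite mul0r.
have -> : phi a0 / phi b0 = phi a / phi b.
  by rewrite a0E b0E !rmorphM -mulf_div divff ?mulr1.
move=> [p p_monic /eqP pab].
have [n szp] : exists n, size p = n.+1.
  by exists (size p).-1; rewrite prednK // size_poly_gt0 monic_neq0.
have pn1 : p`_n = 1 by move/monicP: p_monic; rewrite /lead_coef szp.
(* The monic equation multiplied by [phi b ^+ n], pulled back to k[t] by injectivity. *)
have E : \sum_(i < n.+1) p`_i * (a ^+ i * b ^+ (n - i)) = 0.
  apply: phi_inj; rewrite rmorph_sum rmorph0 /=.
  transitivity (phi b ^+ n * (map_poly phi p).[phi a / phi b]); last first.
    by rewrite pab mulr0.
  rewrite (horner_coef_wide _ (_ : _ <= n.+1)%N); last first.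
    by rewrite -szp; apply: size_poly.
  rewrite mulr_sumr. apply: eq_bigr => i _.
  rewrite coef_map !rmorphM !rmorphXn [RHS]mulrCA; congr (_ * _).
  rewrite expr_div_n [RHS]mulrCA; congr (_ * _).
  have le_in : (i <= n)%N by rewrite -ltnS.
  by rewrite -[X in _ = _ ^+ X / _](subnK le_in) exprD mulfK // expf_neq0.
(* Only the leading term is free of [b]; in all others the exponent [n - i] is positive. *)
have : b %| a ^+ n.
  move: E; rewrite big_ord_recr /= pn1 subnn expr0 mulr1 mul1r => /eqP.
  rewrite addrC addr_eq0 => /eqP ->; rewrite dvdpNr.
  elim/big_ind: _ => [|? ?|i _]; [exact: dvdp0 | exact: dvdp_add |].
  suff b_dvd : b %| b ^+ (n - i) by rewrite dvdp_mull // dvdp_mull.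
  have: (0 < n - i)%N by rewrite subn_gt0.
  by case: (n - i)%N => // m _; rewrite exprS dvdp_mulIl.
move=> b_dvd; have : coprimep b b.
  by apply: (coprimep_dvdl b_dvd); rewrite coprimep_expr // coprimep_sym.
rewrite coprimepp => /eqP szb.
have [c bE] : exists c, b = c%:P by exists b`_0; apply: size1_polyC; rewrite szb.
have c0 : c != 0 by move: szb; rewrite bE size_polyC; case: eqP.
exists (c^-1%:P * a); rewrite bE rmorphM mulrC; congr (_ * _).
apply: (mulfI (_ : phi c%:P != 0)); first by rewrite -bE.
by rewrite -rmorphM -polyCM !divff // ?rmorph1 // -bE.
Qed.

End Integrality.

(** * Degree of k(t) over k(A) *)

Section Degree.

(** Coordinates of each basis in the other give matrices whose product is the identity, by
    uniqueness of coordinates. Their entries lie in [S], but ranks can be compared over [L]. *)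
Lemma basis_over_unique (L : fieldType) (S : set L) (S_field : subfield S)
    (m n : nat) (v : 'I_m -> L) (w : 'I_n -> L) :
  basis_over S v -> basis_over S w -> m = n.
Proof.
have coords p q (v' : 'I_p -> L) (w' : 'I_q -> L) : basis_over S w' ->
    exists M : 'M[L]_(p, q),
      (forall i j, S (M i j)) /\ forall i, v' i = \sum_j M i j * w' j.
  move=> w'B; have [c cP] := choice (fun i => w'B (v' i)).
  exists (\matrix_(i, j) c i j); split=> [i j|i].
    by rewrite mxE; have [[Sc _] _] := cP i.
  by have [[_ ->] _] := cP i; apply: eq_bigr => j _; rewrite mxE.
have S0 : S 0 by rewrite -(subrr 1); apply: subfieldB => //; apply: subfield1.
suff le_dim : forall p q (v' : 'I_p -> L) (w' : 'I_q -> L),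
    basis_over S v' -> basis_over S w' -> (p <= q)%N.
  move=> vB wB; apply/eqP.
  by rewrite eqn_leq (le_dim _ _ _ _ vB wB) (le_dim _ _ _ _ wB vB).
move=> p q v' w' v'B w'B.
have [M [SM ME]] := coords _ _ v' w' w'B; have [N [SN NE]] := coords _ _ w' v' v'B.
suff MN1 : M *m N = 1%:M.
  by rewrite -[p](mxrank1 L) -MN1; apply: leq_trans (mxrankM_maxl _ _) (rank_leq_col _).
apply/matrixP => i j.
have [c [_ c_uniq]] := v'B (v' i).
have cE (c' : 'I_p -> L) : (forall j, S (c' j)) -> v' i = \sum_j c' j * v' j ->
    forall j, c' j = c j.
  move=> Sc' c'E l; rewrite (c_uniq [ffun j => c' j]) ?ffunE //; split=> [l'|].
    by rewrite ffunE.
  by rewrite c'E; apply: eq_bigr => l' _; rewrite ffunE.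
rewrite (cE ((M *m N) i)) ?(cE (1%:M i)) //.
- by move=> l; rewrite mxE; case: (i == l); rewrite ?mulr1n ?mulr0n //; apply: subfield1.
- rewrite (bigD1 i) //= big1 => [|l li]; first by rewrite mxE eqxx mul1r addr0.
  by rewrite mxE eq_sym (negPf li) mul0r.
- move=> l; rewrite mxE; elim/big_ind: _ => // [x y|l' _]; first exact: subfieldD.
  exact: subfieldM.
- rewrite ME; under eq_bigr do rewrite NE mulr_sumr.
  rewrite exchange_big; apply: eq_bigr => l _; rewrite mxE mulr_suml.
  by apply: eq_bigr => l' _; rewrite mulrA.
Qed.

Lemma ext_degreeE (L : fieldType) (S : set L) (S_field : subfield S) n
    (v : 'I_n -> L) : basis_over S v -> ext_degree S = n.
Proof.
move=> vB; apply: xget_unique; first by exists v.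
by move=> m [w wB]; apply: basis_over_unique wB vB.
Qed.

Section PolynomialBasis.
Variables (k : fieldType) (A : {poly k}) (A_nc : (0 < natdeg A)%N).

Let A_neq0 : A != 0.
Proof. by apply: contraTneq A_nc => ->; rewrite /natdeg size_poly0. Qed.

Let sizeA : size A = (natdeg A).+1.
Proof. by rewrite /natdeg prednK // size_poly_gt0. Qed.

(** Expansion of [p] in base [A]: divide repeatedly by [A] and collect the remainders, of degree
    less than deg A. *)
Lemma comp_expansion (p : {poly k}) : exists u : 'I_(natdeg A) -> {poly k},
  p = \sum_i (u i \Po A) * 'X^i.
Proof.
have [n] := ubnP (size p); elim: n p => // n IH p; rewrite ltnS => le_pn.
have [u uE] : exists u : 'I_(natdeg A) -> {poly k},
    p %/ A = \sum_i (u i \Po A) * 'X^i.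
  have [p0|p0] := posnP (size p).
    move/eqP: p0; rewrite size_poly_eq0 => /eqP ->; rewrite div0p.
    by exists (fun=> 0); rewrite big1 // => i _; rewrite comp_poly0 mul0r.
  apply: IH; apply: leq_trans le_pn; rewrite size_divp //.
  by rewrite -/(natdeg A) ltn_subrL A_nc p0.
(* Multiplying the quotient by [A] multiplies each [u i] by ['X], since ['X \Po A = A]; the
   remainder supplies the constant terms. *)
exists (fun i => u i * 'X + ((p %% A)`_i)%:P).
rewrite {1}(divp_eq p A) uE mulr_suml.
rewrite [p %% A in LHS](_ : _ = \sum_(i < natdeg A) ((p %% A)`_i)%:P * 'X^i).
  rewrite -big_split; apply: eq_bigr => i _ /=.
  by rewrite comp_polyD comp_polyM comp_polyX comp_polyC mulrDl mulrAC.
rewrite -[LHS]coefK poly_def (big_ord_widen _ (fun i => (p %% A)`_i *: 'X^i)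
  (_ : _ <= natdeg A)%N); last by rewrite -ltnS -sizeA ltn_modp.
rewrite big_mkcond; apply: eq_bigr => i _; rewrite mul_polyC.
by case: ltnP => // le; rewrite nth_default // scale0r.
Qed.

(** Separating the constant terms of the [u i] gives Q A + C = 0 with deg C < deg A. Uniqueness of
    Euclidean division kills both [Q] and [C], and induction on the size bound applies to [Q]. *)
Lemma comp_expansion_free (u : 'I_(natdeg A) -> {poly k}) :
  \sum_i (u i \Po A) * 'X^i = 0 -> forall i, u i = 0.
Proof.
have [m] : exists m, forall i, (size (u i) <= m)%N.
  by exists (\max_i size (u i)) => i; apply: leq_bigmax.
elim: m u => [|m IH] u szu uA.
  by move=> i; apply/eqP; rewrite -size_poly_leq0.
pose q i := u i %/ 'X; pose c i := (u i).[0].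
have uE i : u i = q i * 'X + (c i)%:P.
  by rewrite /q /c {1}(divp_eq (u i) 'X) -['X]subr0 -polyC0 modp_XsubC.
pose Q := \sum_i (q i \Po A) * 'X^i.
(* [insub] turns a natural index into an ordinal; its default 0 is never reached below
   [natdeg A]. *)
pose C := \poly_(i < natdeg A) (if insub i is Some j then c j else 0).
have CE : C = \sum_(i < natdeg A) (c i)%:P * 'X^i.
  rewrite /C poly_def; apply: eq_bigr => i _; rewrite mul_polyC.
  by rewrite valK.
have E : Q * A + C = 0.
  rewrite -uA CE mulr_suml -big_split; apply: eq_bigr => i _ /=.
  by rewrite uE comp_polyD comp_polyM comp_polyX comp_polyC mulrDl mulrAC.
have szC : (size C < size A)%N by rewrite sizeA ltnS size_poly.
have Q0 : Q = 0.
  by move/(congr1 (fun p => p %/ A)): E; rewrite div0p divp_addl_mul_small.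
have C0 : C = 0 by move: E; rewrite Q0 mul0r add0r.
have c0 i : c i = 0.
  move/(congr1 (fun p : {poly k} => p`_i)): C0; rewrite coef0 coef_poly ltn_ord.
  by rewrite valK.
have q0 : forall i, q i = 0.
  apply: IH Q0 => i; rewrite size_divp ?polyX_eq0 // size_polyX /= subn1.
  by rewrite -ltnS; case: (size (u i)) (szu i).
by move=> i; rewrite uE q0 c0 mul0r addr0.
Qed.

(** Serves to move denominators into k[A]. As t is a root of A(T) - A(t), it is integral over k[A],
    and so is every polynomial in t. *)
Lemma dvdp_comp (p : {poly k}) : p != 0 ->
  exists c q : {poly k}, c != 0 /\ p * q = c \Po A.
Proof.
move=> p0; apply: (@integral_dvd _ _ (comp_poly A)) => //.
have evX (g : {poly k}) : (map_poly (comp_poly A \o polyC) g).['X] = g.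
  rewrite (eq_map_poly (g := polyC)); first exact: comp_polyXr.
  by move=> c /=; rewrite comp_polyC.
rewrite -[p]evX; apply: integral_poly_value.
apply: (@integral_of_poly_value _ _ _ polyC _ A 'X) => //=.
by rewrite comp_polyX evX.
Qed.

Variables (L : fieldType) (phi : {rmorphism {poly k} -> L}).
Hypotheses (phi_inj : injective phi) (phi_frac : forall z, frac_range phi z).

Let S := generated_subfield (range (phi \o polyC) `|` [set phi A]).

Lemma generated_compE : S = frac_range (phi \o comp_poly A).
Proof.
apply/seteqP; split.
  apply: smallest_sub; first exact: subfield_frac_range.
  move=> z [[c _ <-]|->] /=.
    by rewrite -(comp_polyC c A); apply: (range_sub_frac_range (phi \o comp_poly A)).
  by have /= := range_sub_frac_range (phi \o comp_poly A) 'X; rewrite comp_polyX.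
have SS : subfield S by apply: subfield_generated.
have Sp p : S (phi (p \Po A)).
  elim/poly_ind: p => [|p c IH].
    by rewrite comp_poly0 rmorph0 -(subrr 1); apply: (subfieldB SS); apply: subfield1.
  rewrite comp_polyD comp_polyM comp_polyX comp_polyC rmorphD rmorphM.
  apply: (subfieldD SS); first apply: (subfieldM SS) => //.
    by apply: sub_gen_smallest; right.
  by apply: sub_gen_smallest; left; exists c.
by move=> _ [a [b [_ ->]]]; apply: (subfield_div SS); apply: Sp.
Qed.

Lemma power_basis : basis_over S (fun i : 'I_(natdeg A) => phi 'X^i).
Proof.
have SS : subfield S by apply: subfield_generated.
have phi0 p : (phi p == 0) = (p == 0) by rewrite -(rmorph0 phi) (inj_eq phi_inj).
have comp0 (p : {poly k}) : (p \Po A == 0) = (p == 0).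
  exact: comp_nonconstant_eq0.
have S_free (d : 'I_(natdeg A) -> L) : (forall i, S (d i)) ->
    \sum_i d i * phi 'X^i = 0 -> forall i, d i = 0.
  move=> Sd dX0.
  have /choice [uv uvP] : forall i, exists uv : {poly k} * {poly k},
      uv.2 != 0 /\ d i = phi (uv.1 \Po A) / phi (uv.2 \Po A).
    move=> i; have := Sd i; rewrite generated_compE => -[a [b [/= b0 ->]]].
    by exists (a, b); split=> //=; move: b0; rewrite phi0 comp0.
  (* A common denominator [w] of the coefficients; the [u i] are the resulting numerators, to which
     [comp_expansion_free] applies. *)
  pose w := \prod_i (uv i).2.
  pose u i := (uv i).1 * \prod_(j | j != i) (uv j).2.
  have uE i : d i * phi (w \Po A) = phi (u i \Po A).
    have [v0 ->] := uvP i.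
    rewrite /w (bigD1 i) //= /u !comp_polyM !rmorphM /= mulrA divfK //.
    by rewrite phi0 comp0.
  have u0 : forall i, u i = 0.
    apply: comp_expansion_free; apply: phi_inj; rewrite rmorph0 rmorph_sum /=.
    transitivity ((\sum_i d i * phi 'X^i) * phi (w \Po A)); last first.
      by rewrite dX0 mul0r.
    rewrite mulr_suml; apply: eq_bigr => i _.
    by rewrite rmorphM -uE mulrAC.
  move=> i; apply/eqP; have /eqP := uE i; rewrite u0 comp_poly0 rmorph0.
  rewrite mulf_eq0 phi0 comp0 => /orP[//|/eqP w0].
  have : w != 0 by apply/prodf_neq0 => j _; case: (uvP j).
  by rewrite w0 eqxx.
move=> z; have [a [b [b0 ->]]] := phi_frac z.
(* Multiplying numerator and denominator by [q] puts the denominator in k[A], so only the numerator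
   has to be expanded. *)
have [|c [q [c0 bq]]] := @dvdp_comp b; first by rewrite -phi0.
have [u uE] := comp_expansion (a * q).
have q0 : q != 0.
  by apply: contraNneq c0 => q0; rewrite -comp0 -bq q0 mulr0.
pose v := [ffun i => phi (u i \Po A) / phi (c \Po A)].
have Sv i : S (v i).
  by rewrite ffunE generated_compE; exists (u i), c; split=> //=; rewrite phi0 comp0.
have vE : phi a / phi b = \sum_i v i * phi 'X^i.
  have -> : phi a / phi b = phi (a * q) / phi (c \Po A).
    by rewrite -bq !rmorphM -mulf_div divff ?mulr1 // phi0.
  rewrite uE rmorph_sum mulr_suml; apply: eq_bigr => i _.
  by rewrite ffunE rmorphM mulrAC.
exists v; split=> // v' [Sv' v'E]; apply/ffunP => i; apply: subr0_eq.
apply: (S_free (fun i => v i - v' i)) => [j|]; first exact: (subfieldB SS).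
by under eq_bigr do rewrite mulrBl; rewrite sumrB -vE -v'E subrr.
Qed.

End PolynomialBasis.
End Degree.

(** * Kernels of evaluation under extension of the base field *)

Section BaseChange.
Variables (k K : fieldType) (iota : {rmorphism k -> K}).

Definition independent_over n (e : 'I_n -> K) : Prop :=
  forall c : 'I_n -> k, \sum_i iota (c i) * e i = 0 -> forall i, c i = 0.

(** A polynomial has finitely many coefficients, so a basis of their span replaces a k-basis of [K].
    A new element joins the basis only when it is outside the span of the previous ones. *)
Lemma finite_span_basis (s : seq K) : exists n (e : 'I_n -> K),
  independent_over e /\
  {in s, forall x, exists c : 'I_n -> k, x = \sum_i iota (c i) * e i}.
Proof.
elim: s => [|x s [n [e [e_free es]]]].
  by exists 0, (fun=> 0); split=> // c _ [].
have [xe|xNe] := pselect (exists c : 'I_n -> k, x = \sum_i iota (c i) * e i).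
  by exists n, e; split=> // y; rewrite inE => /orP[/eqP ->|/es].
pose e' (i : 'I_n.+1) := if unlift ord0 i is Some j then e j else x.
have e'0 : e' ord0 = x by rewrite /e' unlift_none.
have e'S j : e' (lift ord0 j) = e j by rewrite /e' liftK.
have e'E (c : 'I_n.+1 -> k) : \sum_i iota (c i) * e' i =
    iota (c ord0) * x + \sum_j iota (c (lift ord0 j)) * e j.
  by rewrite big_ord_recl e'0; under eq_bigr do rewrite e'S.
exists n.+1, e'; split=> [c|y].
  rewrite e'E; have [c0|c0] := eqVneq (c ord0) 0.
    rewrite c0 rmorph0 mul0r add0r => /e_free cS i.
    by case: (unliftP ord0 i) => [j|] ->.
  (* A relation with nonzero coefficient at [x] would put [x] in the span of [e]. *)
  move/eqP; rewrite addr_eq0 => /eqP cx; case: xNe.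
  exists (fun j => - ((c ord0)^-1 * c (lift ord0 j))).
  have ic0 : iota (c ord0) != 0 by rewrite fmorph_eq0.
  apply: (mulfI ic0); rewrite cx mulr_sumr -sumrN; apply: eq_bigr => j _.
  by rewrite rmorphN rmorphM fmorphV mulNr mulrN !mulrA divff ?mul1r.
rewrite inE => /orP[/eqP ->|/es [c ->]].
  exists (fun i => if i == ord0 then 1 else 0); rewrite e'E eqxx rmorph1 mul1r.
  by rewrite big1 ?addr0 // => j _; rewrite rmorph0 mul0r.
exists (fun i => if unlift ord0 i is Some j then c j else 0).
rewrite e'E unlift_none rmorph0 mul0r add0r.
by apply: eq_bigr => j _; rewrite liftK.
Qed.

Definition base_change (p : bipoly k) : bipoly K := map_poly (map_poly iota) p.
Definition base_change_source (s : {poly k} * {poly k}) :=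
  (map_poly iota s.1, map_poly iota s.2).

Lemma base_change_scalar2 c : base_change (scalar2 c) = scalar2 (iota c).
Proof. by rewrite /base_change /scalar2 map_polyC /= map_polyC. Qed.

Lemma base_change_varX : base_change (varX k) = varX K.
Proof. by rewrite /base_change /varX map_polyC /= map_polyX. Qed.

Lemma base_change_varY : base_change (varY k) = varY K.
Proof. by rewrite /base_change /varY map_polyX. Qed.

Lemma ev_base_change s p :
  ev (base_change_source s) (base_change p) = map_poly iota (ev s p).
Proof.
apply: (@bipoly_morphE _ _ (ev (base_change_source s) \o map_poly (map_poly iota))
  (map_poly iota \o ev s)) => [c||] /=.
- by rewrite -/(base_change _) base_change_scalar2 !ev_scalar2 map_polyC.
- by rewrite -/(base_change _) base_change_varX !ev_varX.
- by rewrite -/(base_change _) base_change_varY !ev_varY.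
Qed.

(** Write q as the sum of the e_i p_i with p_i over [k] and the e_i independent. Then 0 is the sum
    of the e_i times the values of the p_i, so independence, coefficient by coefficient, puts each
    p_i in the kernel over [k]. *)
Lemma ev_kernel_base_change s (q : bipoly K) :
    ev (base_change_source s) q = 0 ->
  exists n, exists (a : 'I_n -> bipoly K) (p : 'I_n -> bipoly k),
    (forall i, ev s (p i) = 0) /\ q = \sum_i a i * base_change (p i).
Proof.
(* Listing 0 explicitly forces [C 0 i = 0], which makes [map_poly] act coefficientwise, and covers
   coefficients out of range. *)
move=> q0; pose coefs := 0 :: flatten [seq polyseq r | r : {poly K} <- q].
have [n [e [e_free es]]] := finite_span_basis coefs.
have in_coefs j i : q`_j`_i \in coefs.
  have [lj|lj] := ltnP j (size q); last by rewrite (nth_default _ lj) coef0 inE eqxx.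
  have [li|li] := ltnP i (size q`_j); last by rewrite (nth_default _ li) inE eqxx.
  rewrite inE; apply/orP; right; apply/flatten_mapP; exists q`_j; exact: mem_nth.
have /choice [C CE] : forall x, exists c : 'I_n -> k,
    x \in coefs -> x = \sum_i iota (c i) * e i.
  move=> x; have [/es [c ->]|//] := boolP (x \in coefs); first by exists c.
  by exists (fun=> 0).
have C0 i : C 0 i = 0 by apply: e_free; rewrite -CE // inE eqxx.
pose p i : bipoly k := map_poly (map_poly (C^~ i)) q.
have pE i j l : (p i)`_j`_l = C q`_j`_l i.
  by rewrite coef_map_id0 ?map_poly0 // coef_map_id0.
have qE : q = \sum_i scalar2 (e i) * base_change (p i).
  apply/polyP => j; apply/polyP => l; rewrite (CE _ (in_coefs j l)) !coef_sum.
  by apply: eq_bigr => i _; rewrite !coefCM !coef_map /= pE mulrC.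
exists n, (fun i => scalar2 (e i)), p; split=> // i.
apply/polyP => l; rewrite coef0; move: i; apply: e_free.
transitivity (ev (base_change_source s) q)`_l; last by rewrite q0 coef0.
rewrite [in RHS]qE rmorph_sum coef_sum; apply: eq_bigr => i _.
by rewrite rmorphM /= ev_base_change ev_scalar2 coefCM coef_map mulrC.
Qed.

End BaseChange.

(* The evaluation e : R -> k[t] need not be onto; t is only the quotient
   e U / e V, so a factorization of h sends t to h U / h V, and comparing values
   amounts to clearing powers of V. *)
Lemma rmorphism_factor (k L : fieldType) (R : comNzRingType)
    (iota : {rmorphism k -> R}) (e : {rmorphism R -> {poly k}})
    (h : {rmorphism R -> L}) (U V : R) :
    (forall c, e (iota c) = c%:P) -> (forall p, (h p == 0) = (e p == 0)) ->
    e V != 0 -> 'X * e V = e U ->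
  exists2 phi : {rmorphism {poly k} -> L},
    injective phi & forall p, phi (e p) = h p.
Proof.
move=> eC h_eq0 V0 UV; have hV : h V != 0 by rewrite h_eq0.
pose tau := h U / h V.
have [phi phic phiX] : exists2 phi : {rmorphism {poly k} -> L},
    forall c, phi c%:P = h (iota c) & phi 'X = tau.
  exists (horner_eval tau \o map_poly (h \o iota)) => [c|] /=.
    by rewrite map_polyC /= horner_evalE hornerC.
  by rewrite map_polyX horner_evalE hornerX.
have homog p : exists n W, e W = p * e V ^+ n /\ h W = phi p * h V ^+ n.
  elim/poly_ind: p => [|p c [n [W [eW hW]]]].
    by exists 0%N, 0; rewrite !rmorph0 !mul0r.
  exists n.+1, (W * U + iota c * V ^+ n.+1).
  have tauV : tau * h V = h U by rewrite divfK.
  rewrite !rmorphD !rmorphM !rmorphXn eW hW -UV eC phic phiX -tauV.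
  by split; rewrite mulrACA -exprSr -mulrDl.
exists phi.
  apply: raddf_inj => p phip; have [n [W [eW hW]]] := homog p.
  move/eqP: hW; rewrite phip mul0r h_eq0 eW mulf_eq0.
  by rewrite expf_eq0 (negPf V0) andbF orbF => /eqP.
move=> q; have [n [W [eW hW]]] := homog (e q).
have : h (W - q * V ^+ n) == 0 by rewrite h_eq0 rmorphB rmorphM rmorphXn eW subrr.
rewrite rmorphB rmorphM rmorphXn hW subr_eq0.
by rewrite (inj_eq (mulIf (expf_neq0 n hV))) => /eqP.
Qed.

(** * The coordinate ring and function field as targets of morphisms *)

Section CurveFunctions.
Variables (k : fieldType) (P : prime_idealr (bipoly k)).

Definition to_coord (p : bipoly k) : coord_ring P := \pi_({ideal_quot P})%qT p.

Lemma to_coord_is_zmod_morphism : zmod_morphism to_coord.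
Proof. by move=> p q; rewrite /to_coord rmorphB. Qed.
Lemma to_coord_is_monoid_morphism : monoid_morphism to_coord.
Proof. by split=> [|p q]; rewrite /to_coord ?rmorph1 ?rmorphM. Qed.
HB.instance Definition _ :=
  GRing.isZmodMorphism.Build _ _ to_coord to_coord_is_zmod_morphism.
HB.instance Definition _ :=
  GRing.isMonoidMorphism.Build _ _ to_coord to_coord_is_monoid_morphism.
HB.instance Definition _ :=
  GRing.RMorphism.copy (curve_fun P) (@tofrac (coord_ring P) \o to_coord).
HB.instance Definition _ :=
  GRing.RMorphism.copy (@const k P) (curve_fun P \o @polyC {poly k} \o @polyC k).

Lemma to_coord_eq0 p : (to_coord p == 0) = (p \in P).
Proof.
by rewrite -[p in RHS]subr0 Quotient.idealrBE -(rmorph0 to_coord).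
Qed.

Lemma to_coord_surj x : exists p, x = to_coord p.
Proof. by elim/quotW: x => p; exists p. Qed.

Lemma curve_fun_eq0 p : (curve_fun P p == 0) = (p \in P).
Proof. by rewrite -to_coord_eq0; apply: tofrac_eq0. Qed.

Lemma curve_fun_frac z : exists a b, curve_fun P b != 0 /\
  z = curve_fun P a / curve_fun P b.
Proof.
have [x [y [y0 ->]]] := fractionE z.
have [a xa] := to_coord_surj x; have [b yb] := to_coord_surj y.
by exists a, b; rewrite xa yb; split=> //; rewrite curve_fun_eq0 -to_coord_eq0 -yb.
Qed.

Lemma integral_curve_fun p : integralOver (@tofrac (coord_ring P)) (curve_fun P p).
Proof. exact: (integral_id (@tofrac (coord_ring P)) (to_coord p)). Qed.

Lemma eval_ffE (phi : {rmorphism {poly k} -> {fraction coord_ring P}}) :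
  (forall c, phi c%:P = const P c) -> forall p, phi p = eval_ff p (phi 'X).
Proof.
move=> phic p; rewrite /eval_ff -(eq_map_poly (f := phi \o polyC)) //.
rewrite map_poly_comp horner_map; congr (phi _); exact: esym (comp_polyXr p).
Qed.

End CurveFunctions.

(** * Parametrizations of a component by a line *)

Section Parametrization.
Variable k : fieldType.
Implicit Types (P : prime_idealr (bipoly k)) (s : {poly k} * {poly k}).

Definition kernel_is P s := forall p, (p \in P) = (ev s p == 0).

(** One equation on all of k[X, Y] stating that [phi] fixes constants and sends the pair [s] to the
    coordinates X and Y. *)
Definition parametrizes P s (phi : {rmorphism {poly k} -> {fraction coord_ring P}}) :=
  forall p, phi (ev s p) = curve_fun P p.

Lemma parametrizes_coords P s (phi : {rmorphism {poly k} -> {fraction coord_ring P}}) :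
    (forall c, phi c%:P = const P c) -> phi s.1 = coordX P -> phi s.2 = coordY P ->
  parametrizes s phi.
Proof.
move=> phic phi1 phi2.
apply: (@bipoly_morphE _ _ (phi \o ev s) (curve_fun P)) => [c||] /=.
- by rewrite ev_scalar2 phic.
- by rewrite ev_varX.
- by rewrite ev_varY.
Qed.

Lemma line_iso_parametrizes P (phi : {rmorphism {poly k} -> {fraction coord_ring P}}) :
  line_iso P phi -> exists s, parametrizes s phi.
Proof.
move=> [phic phi_inj phi_range].
have [A _ AX] : range phi (coordX P) by rewrite phi_range; apply: integral_curve_fun.
have [B _ BY] : range phi (coordY P) by rewrite phi_range; apply: integral_curve_fun.
by exists (A, B); apply: parametrizes_coords.
Qed.

Section Theory.
Variables (P : prime_idealr (bipoly k)) (s : {poly k} * {poly k}).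
Variable phi : {rmorphism {poly k} -> {fraction coord_ring P}}.
Hypotheses (phi_inj : injective phi) (s_phi : parametrizes s phi).

Lemma parametrizes_kernel : kernel_is P s.
Proof. by move=> p; rewrite -curve_fun_eq0 -s_phi -(rmorph0 phi) (inj_eq phi_inj). Qed.

Lemma parametrizes_frac z : frac_range phi z.
Proof.
have [a [b [b0 ->]]] := curve_fun_frac z.
by exists (ev s a), (ev s b); rewrite !s_phi.
Qed.

Lemma parametrizes_generates : exists U V, ev s V != 0 /\ 'X * ev s V = ev s U.
Proof.
have [a [b [b0 Xab]]] := curve_fun_frac (phi 'X).
exists a, b; split; first by apply: contraNneq b0; rewrite -s_phi => ->; rewrite rmorph0.
by apply: phi_inj; rewrite rmorphM !s_phi Xab divfK.
Qed.

End Theory.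

(** Comparing degrees, if one of A, B is constant then both are. Then [ev s U] is constant, whereas
    ['X * ev s V] has positive degree. *)
Lemma generates_nonconstant f g s :
    (0 < natdeg f)%N -> (0 < natdeg g)%N -> f \Po s.1 = g \Po s.2 ->
    (exists U V, ev s V != 0 /\ 'X * ev s V = ev s U) ->
  (0 < natdeg s.1)%N /\ (0 < natdeg s.2)%N.
Proof.
move=> f_nc g_nc /(congr1 (@natdeg k)); rewrite !natdeg_comp => E [U [V [V0 UV]]].
have [A0|A_nc] := posnP (natdeg s.1); last first.
  by split=> //; rewrite -(ltn_pmul2l g_nc) muln0 -E muln_gt0 f_nc.
have B0 : natdeg s.2 = 0%N.
  by move/eqP: E; rewrite A0 muln0 eq_sym muln_eq0 (gtn_eqF g_nc) => /eqP.
have := ev_const A0 B0 U; rewrite -UV mulrC size_mulX //.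
by rewrite ltnS leqn0 size_poly_eq0 (negPf V0).
Qed.

Lemma primitive_parametrizes f g P s : primitive_source f g s -> kernel_is P s ->
  exists2 phi, line_iso P phi & parametrizes s phi.
Proof.
move=> [A_nc B_nc _ /primitive_generated[U [V [V0 UV]]]] sP.
have [phi phi_inj s_phi] : exists2 phi : {rmorphism {poly k} -> {fraction coord_ring P}},
    injective phi & parametrizes s phi.
  apply: (@rmorphism_factor _ _ _ (@polyC {poly k} \o @polyC k) (ev s) (curve_fun P) U V).
  - by move=> c; rewrite -[LHS]/(ev s (scalar2 c)) ev_scalar2.
  - by move=> p; rewrite curve_fun_eq0 sP.
  - by [].
  - by [].
have phic c : phi c%:P = const P c by rewrite -(ev_scalar2 s) s_phi.
exists phi => //; split=> //; apply/seteqP; split=> z.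
- pose iota : {rmorphism k -> coord_ring P} :=
    @to_coord k P \o @polyC {poly k} \o @polyC k.
  have phiE p : phi p = (map_poly (@tofrac (coord_ring P) \o iota) p).[phi 'X].
    exact: eval_ffE.
  move=> [p _ <-]; rewrite phiE; apply: integral_poly_value.
  (* The equation making t integral is A(t) = X. *)
  apply: (integral_of_poly_value (r := to_coord P (varX k)) A_nc).
  by apply: etrans (esym (phiE s.1)) _; rewrite -(ev_varX s) s_phi.
(* An element integral over the coordinate ring is integral over k[t], whose image contains that
   ring. *)
- move=> /(@integral_sub_range _ _ _ _ phi) z_int.
  have {}z_int : integralOver phi z.
    apply: z_int => x; have [q ->] := to_coord_surj x.
    by exists (ev s q); rewrite s_phi.
  have [q ->] := poly_integrally_closed phi_inj (parametrizes_frac s_phi z) z_int.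
  by exists q.
Qed.

End Parametrization.

(** * The kernel of evaluation as a prime ideal *)

Section KernelIdeal.
Variables (k : fieldType) (s : {poly k} * {poly k}).

Definition ev_kernel : pred (bipoly k) := fun p => ev s p == 0.

Lemma ev_kernel_idealr : idealr_closed ev_kernel.
Proof.
split; rewrite ?unfold_in /ev_kernel ?ev0 ?ev1 ?oner_eq0 //.
move=> a u v; rewrite !unfold_in => /eqP u0 /eqP v0.
by rewrite evD evM u0 v0 mulr0 addr0.
Qed.

Lemma ev_kernel_prime : prime_idealr_closed ev_kernel.
Proof. by move=> u v; rewrite !unfold_in /ev_kernel evM mulf_eq0. Qed.

HB.instance Definition _ := isIdealr.Build _ ev_kernel ev_kernel_idealr.
HB.instance Definition _ := isPrimeIdealrClosed.Build _ ev_kernel ev_kernel_prime.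

End KernelIdeal.

(** * Components, affine reparametrization and graphs *)

Section Components.
Variables (k : fieldType) (f g : {poly k}).
Implicit Types (P Q : prime_idealr (bipoly k)) (s : {poly k} * {poly k}).

(** The structure packs a predicate with proofs: extensionality identifies the predicates, proof
    irrelevance the rest. *)
Lemma prime_idealr_eq P Q : P =i Q -> P = Q.
Proof.
case: P Q => [P [a b c d]] [Q [a' b' c' d']] PQ.
have PQ' : P = Q by apply/funext => x; apply: PQ.
subst Q; clear PQ; congr (PrimeIdealr.Pack (PrimeIdealr.Class _ _ _ _)).
- by case: a a' => [a] [a']; rewrite (Prop_irrelevance a a').
- by case: b b' => [b] [b']; rewrite (Prop_irrelevance b b').
- by case: c c' => [c] [c']; rewrite (Prop_irrelevance c c').
- by case: d d' => [d] [d']; rewrite (Prop_irrelevance d d').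
Qed.

(** A prime ideal is radical, so only the generator has to be tested. *)
Lemma curve_ideal_sub P : curve_ideal f g `<=` [set` P] <-> inX f - inY g \in P.
Proof.
split=> [/(_ (inX f - inY g)) | FP p [n [q pq]]].
  by apply; exists 1%N, 1; rewrite expr1 mul1r.
have : p ^+ n \in P by rewrite pq; apply: idealMr.
elim: n {pq} => [|n IH]; first by rewrite expr0 idealr1.
by rewrite exprS prime_idealrM => /orP[].
Qed.

(* On a curve f(X) = g(Y), every function is integral over k[X]. *)
Lemma curve_dvd (D : idomainType) (h : {rmorphism bipoly k -> D}) (p : bipoly k) :
    (0 < natdeg g)%N -> h (inX f) = h (inY g) -> h p != 0 ->
  exists c y, c != 0 /\ h p * y = h (inX c).
Proof.
move=> g_nc hfg hp0; apply: (@integral_dvd _ _ (h \o @polyC {poly k}) _ hp0).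
have hE (q : bipoly k) : h q = (map_poly (h \o @polyC {poly k}) q).[h 'X].
  by rewrite map_poly_comp horner_map; congr (h _); exact: esym (comp_polyXr q).
have Y_int : integralOver (h \o @polyC {poly k}) (h 'X).
  apply: (integral_of_poly_value (iota := @polyC k) (r := f) g_nc).
  by rewrite map_poly_comp -hE.
rewrite hE; apply: integral_horner Y_int; apply/integral_poly => i.
by rewrite coef_map; apply: integral_id.
Qed.

Lemma kernel_component s P : (0 < natdeg g)%N -> (0 < natdeg s.1)%N ->
  kernel_is P s -> f \Po s.1 = g \Po s.2 -> component f g P.
Proof.
move=> g_nc A_nc sP fg; split.
  by apply/curve_ideal_sub; rewrite sP ev_curve fg subrr.
move=> Q /curve_ideal_sub FQ QP; apply/seteqP; split=> // p Pp.
apply: contrapT => /negP pNQ.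
pose h : {rmorphism bipoly k -> coord_ring Q} := @to_coord k Q.
have h_eq0 q : (h q == 0) = (q \in Q) by apply: to_coord_eq0.
have [||c [y [c0 pyc]]] := @curve_dvd _ h p g_nc.
- by apply/eqP; rewrite -subr_eq0 -(rmorphB h) h_eq0.
- by rewrite h_eq0.
have [q yq] := to_coord_surj y.
have : p * q - inX c \in Q.
  by rewrite -h_eq0 (rmorphB h) (rmorphM h) -pyc yq subrr.
(* Passing from [Q] to [P] and evaluating at [s] kills [p] and leaves c(A) = 0. *)
move=> /QP; rewrite /= sP evB evM.
have /eqP -> : ev s p == 0 by rewrite -sP.
by rewrite mul0r sub0r oppr_eq0 ev_inX comp_nonconstant_eq0 // (negPf c0).
Qed.

(** The extended ideal is again the kernel of an evaluation, now into the domain K[t], hence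
    prime. *)
Lemma kernel_geometrically_integral s P : kernel_is P s -> geometrically_integral P.
Proof.
move=> sP K iota; pose sK := base_change_source iota s.
have -> : extended_ideal P iota = [set q | ev sK q = 0].
  apply/seteqP; split=> q.
    move=> [n [a [p [pP ->]]]] /=.
    elim/big_ind: _ => [|x y x0 y0|i _]; first exact: ev0.
      by rewrite evD x0 y0 addr0.
    rewrite evM -/(base_change _ _) ev_base_change.
    by move: (pP i); rewrite sP => /eqP ->; rewrite rmorph0 mulr0.
  move=> /ev_kernel_base_change[n [a [p [pP qE]]]].
  by exists n, a, p; split=> // i; rewrite sP pP.
split; first split.
- by rewrite inE /= ev0.
- by apply/negP; rewrite inE /= ev1; apply/eqP; rewrite oner_eq0.
- move=> a u v; rewrite !inE /= => u0 v0.
  by rewrite evD evM u0 v0 mulr0 addr0.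
- move=> u v; rewrite inE /= evM => /eqP; rewrite mulf_eq0.
  by move=> /orP[]/eqP ?; apply/orP; [left|right]; rewrite inE.
Qed.

Lemma poly_rmorph_eq (R : nzRingType) (h1 h2 : {rmorphism {poly k} -> R}) :
  (forall c, h1 c%:P = h2 c%:P) -> h1 'X = h2 'X -> h1 =1 h2.
Proof.
move=> hc hX; elim/poly_ind => [|p c IH]; first by rewrite !rmorph0.
by rewrite !rmorphD !rmorphM IH hX hc.
Qed.

Lemma natdeg1_affine (T : {poly k}) : natdeg T = 1%N ->
  exists a b, a != 0 /\ T = a *: 'X + b%:P.
Proof.
move=> T1; have szT : size T = 2 by move: T1; rewrite /natdeg; case: size => [|[|[]]].
exists T`_1, T`_0; split.
  by have := lead_coef_eq0 T; rewrite /lead_coef szT /= => ->; rewrite -size_poly_eq0 szT.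
apply/polyP => -[|[|i]]; rewrite coefD coefZ coefX coefC /=;
  rewrite ?mulr0 ?mulr1 ?addr0 ?add0r //.
by rewrite nth_default // szT.
Qed.

Lemma natdeg_affine (a b : k) : a != 0 -> natdeg (a *: 'X + b%:P) = 1%N.
Proof.
move=> a0; rewrite /natdeg -mul_polyC size_MXaddC polyC_eq0 (negPf a0) /=.
by rewrite size_polyC a0.
Qed.

(** Both parametrizations have the normalization as image, so each parameter is a polynomial in the
    other. These polynomials are inverse under composition, hence of degree one. *)
Lemma kernel_affine s s' P : primitive_source f g s -> primitive_source f g s' ->
  kernel_is P s -> kernel_is P s' -> affine_class s' s.
Proof.
move=> s_prim s'_prim sP s'P.
have [phi' [phi'c phi'_inj phi'_range] s'_phi'] := primitive_parametrizes s'_prim s'P.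
have [phi [phic phi_inj phi_range] s_phi] := primitive_parametrizes s_prim sP.
have [T _ T_X] : range phi (phi' 'X) by rewrite phi_range -phi'_range; exists 'X.
have [T' _ T'_X] : range phi' (phi 'X) by rewrite phi'_range -phi_range; exists 'X.
have phi'E : phi' =1 phi \o comp_poly T.
  by apply: poly_rmorph_eq => [c|] /=; rewrite ?comp_polyC ?comp_polyX // phic phi'c.
have TT' : natdeg T = 1%N.
  have /(congr1 (@natdeg k)) : 'X = T' \Po T.
    by apply: phi_inj; rewrite -T'_X phi'E.
  rewrite natdeg_comp {1}/natdeg size_polyX => /esym/eqP.
  by rewrite muln_eq1 => /andP[_ /eqP].
have [a [b [a0 TE]]] := natdeg1_affine TT'.
exists a, b; split=> //; rewrite -TE [LHS]surjective_pairing; congr (_, _).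
  by apply: phi_inj; rewrite -[RHS]phi'E -(ev_varX s') -(ev_varX s) s'_phi' s_phi.
by apply: phi_inj; rewrite -[RHS]phi'E -(ev_varY s') -(ev_varY s) s'_phi' s_phi.
Qed.

Lemma primitive_affine s s' : (0 < natdeg f)%N -> (0 < natdeg g)%N ->
  primitive_source f g s -> affine_class s s' -> primitive_source f g s'.
Proof.
move=> f_nc g_nc [_ _ fg /primitive_generated[U [V [V0 UV]]]] [a [b [a0 ->]]].
set T := a *: 'X + b%:P; pose s1 := (s.1 \Po T, s.2 \Po T).
have fg1 : f \Po s1.1 = g \Po s1.2 by rewrite /= !comp_polyA fg.
have gen1 : exists U V, ev s1 V != 0 /\ 'X * ev s1 V = ev s1 U.
  (* From T = a t + b one gets t = (T - b) / a, while U / V now evaluates to T. *)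
  exists (scalar2 a^-1 * (U - scalar2 b * V)), V; split.
    by rewrite ev_comp comp_nonconstant_eq0 ?natdeg_affine.
  rewrite evM evB evM !ev_scalar2 !ev_comp -UV comp_polyM comp_polyX -mulrBl.
  by rewrite /T addrK mulrA mul_polyC scalerA mulVf // scale1r.
have [A_nc B_nc] := generates_nonconstant f_nc g_nc fg1 gen1.
by split=> //; apply/primitive_generated.
Qed.

Lemma kernel_is_affine s s' P : affine_class s s' -> kernel_is P s -> kernel_is P s'.
Proof.
move=> [a [b [a0 ->]]] sP p.
by rewrite sP ev_comp comp_nonconstant_eq0 // natdeg_affine.
Qed.

Lemma kernel_graph s P : (0 < natdeg s.1)%N -> f \Po s.1 = g \Po s.2 ->
  kernel_is P s -> graph_component f g P <-> exists h : {poly k}, s.2 = h \Po s.1.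
Proof.
move=> A_nc fg sP.
have comp_inj (p : {poly k}) : p \Po s.1 = 0 -> p = 0.
  by move=> /eqP; rewrite comp_nonconstant_eq0 // => /eqP.
split=> [[h _ hP]|[h sh]].
  have : [set` P] (varY k - inX h) by rewrite hP; exists 1 => //; rewrite mul1r.
  rewrite /= sP evB ev_varY ev_inX subr_eq0 => /eqP ->.
  by exists h.
exists h.
  (* The relation f(A) = g(h(A)) yields f = g(h), as composition with the nonconstant A is
     injective. *)
  apply/eqP; rewrite -subr_eq0; apply/eqP/comp_inj.
  by rewrite comp_polyB fg sh comp_polyA subrr.
have Yh : ev s (varY k - inX h) = 0 by rewrite evB ev_varY ev_inX sh subrr.
apply/seteqP; split=> [p|_ [q _ <-]] /=; rewrite sP; last by rewrite evM Yh mulr0.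
move=> /eqP p0.
(* Division by Y - h(X) leaves the remainder p(X, h(X)), which vanishes because its value at A
   does. *)
have [q qE] : exists q, p - inX p.[h] = q * (varY k - inX h).
  by apply/factor_theorem; rewrite rootE !hornerE subrr.
have : p.[h] \Po s.1 = 0.
  have := congr1 (ev s) qE; rewrite evM Yh mulr0 evB p0 ev_inX sub0r => /eqP.
  by rewrite oppr_eq0 => /eqP.
by move=> /comp_inj ph; exists q => //; rewrite -qE ph /inX polyC0 subr0.
Qed.

Lemma map_degreeE P (phi : {rmorphism {poly k} -> {fraction coord_ring P}})
    (A : {poly k}) : (forall c, phi c%:P = const P c) -> injective phi ->
    (forall z, frac_range phi z) -> (0 < natdeg A)%N ->
  map_degree P (phi A) = natdeg A.
Proof.
move=> phic phi_inj phi_frac A_nc.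
have constE : @const k P = phi \o polyC by apply/funext => c /=; rewrite phic.
rewrite /map_degree constE.
exact: ext_degreeE (subfield_generated _) _ _ (power_basis A_nc phi_inj phi_frac).
Qed.

End Components.

(** * The bijection between components and source classes *)

Section Correspondence.
Variables (k : fieldType) (f g : {poly k}).
Hypotheses (f_nc : (0 < natdeg f)%N) (g_nc : (0 < natdeg g)%N).
Implicit Types (P Q : prime_idealr (bipoly k)) (s : {poly k} * {poly k}).

(** Taking all sources of [P] avoids choosing one; for a line component they form a single affine
    class. *)
Definition component_sources P : set ({poly k} * {poly k}) :=
  [set s | primitive_source f g s /\ kernel_is P s].

Lemma parametrizes_component_source P s
    (phi : {rmorphism {poly k} -> {fraction coord_ring P}}) :
    component f g P -> injective phi -> parametrizes s phi ->
  component_sources P s.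
Proof.
move=> [/curve_ideal_sub FP _] phi_inj s_phi.
have sP := parametrizes_kernel phi_inj s_phi.
have fg : f \Po s.1 = g \Po s.2.
  by apply/eqP; rewrite -subr_eq0 -ev_curve -sP.
have gen := parametrizes_generates phi_inj s_phi.
have [A_nc B_nc] := generates_nonconstant f_nc g_nc fg gen.
by split=> //; split=> //; apply/primitive_generated.
Qed.

Lemma line_component_source P : line_components f g P -> exists s, component_sources P s.
Proof.
move=> [P_comp _ [phi phi_iso]]; have [s s_phi] := line_iso_parametrizes phi_iso.
by exists s; case: phi_iso => _ phi_inj _; apply: parametrizes_component_source s_phi.
Qed.

Lemma component_sourcesE P s : component_sources P s ->
  component_sources P = affine_class s.
Proof.
move=> [s_prim sP]; apply/seteqP; split=> s'.
  by move=> [s'_prim s'P]; exact: kernel_affine s'_prim s_prim s'P sP.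
move=> ss'; split; first exact: primitive_affine ss'.
exact: kernel_is_affine ss' sP.
Qed.

Lemma component_source_line P s : component_sources P s -> line_components f g P.
Proof.
move=> [s_prim sP]; have [A_nc _ fg _] := s_prim; split.
- exact: kernel_component sP fg.
- exact: kernel_geometrically_integral sP.
- by have [phi phi_iso _] := primitive_parametrizes s_prim sP; exists phi.
Qed.

Lemma component_sources_bij :
  set_bij (line_components f g) (source_classes f g) component_sources.
Proof.
split.
- move=> P /line_component_source[s sP]; exists s; first by case: sP.
  by rewrite (component_sourcesE sP).
(* A common source determines both ideals as its kernel. *)
- move=> P Q; rewrite !inE => /line_component_source[s sP] _ PQ.
  have [_ sQ] : component_sources Q s by rewrite -PQ.
  by apply: prime_idealr_eq => p; case: sP => _ ->; rewrite sQ.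
- move=> _ [s s_prim <-]; exists (ev_kernel s : prime_idealr (bipoly k)).
    exact: (@component_source_line _ s).
  exact: component_sourcesE.
Qed.

End Correspondence.

Theorem theorem2p6 (k : fieldType) (char0 : [pchar k] =i pred0)
    (f g : {poly k}) (f_nc : (0 < natdeg f)%N) (g_nc : (0 < natdeg g)%N) :
  exists Phi : prime_idealr (bipoly k) -> set ({poly k} * {poly k}),
    set_bij (line_components f g) (source_classes f g) Phi /\
    forall P, line_components f g P ->
      (forall t, coordinate P t -> exists A B : {poly k},
         [/\ Phi P (A, B), coordX P = eval_ff A t & coordY P = eval_ff B t]) /\
      (forall A B : {poly k}, Phi P (A, B) ->
         [/\ exists t, [/\ coordinate P t, coordX P = eval_ff A t
                         & coordY P = eval_ff B t],
             dX P = natdeg A,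
             dY P = natdeg B,
             (natdeg f * natdeg A = natdeg g * natdeg B)%N
           & graph_component f g P <-> exists h : {poly k}, B = h \Po A]).
Proof.
exists (component_sources f g); split; first exact: component_sources_bij.
move=> P [P_comp _ _].
have coordsE s (phi : {rmorphism {poly k} -> {fraction coord_ring P}}) :
    (forall c, phi c%:P = const P c) -> parametrizes s phi ->
    [/\ phi s.1 = coordX P, phi s.2 = coordY P,
        coordX P = eval_ff s.1 (phi 'X) & coordY P = eval_ff s.2 (phi 'X)].
  move=> phic s_phi.
  have X : phi s.1 = coordX P by rewrite -(ev_varX s) s_phi.
  have Y : phi s.2 = coordY P by rewrite -(ev_varY s) s_phi.
  by split=> //; [rewrite -X | rewrite -Y]; apply: eval_ffE.
split=> [_ [phi phi_iso <-]|A B AB].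
  have [s s_phi] := line_iso_parametrizes phi_iso.
  have [phic phi_inj _] := phi_iso; have [_ _ X Y] := coordsE _ _ phic s_phi.
  exists s.1, s.2; rewrite -surjective_pairing; split=> //.
  exact: parametrizes_component_source s_phi.
have [AB_prim ABP] := AB; have [/= A_nc B_nc fg _] := AB_prim.
have [phi phi_iso s_phi] := primitive_parametrizes AB_prim ABP.
have [phic phi_inj _] := phi_iso; have [XA YB X Y] := coordsE _ _ phic s_phi.
have phi_frac := parametrizes_frac s_phi.
split.
- by exists (phi 'X); split=> //; exists phi.
- by rewrite /dX -XA map_degreeE.
- by rewrite /dY -YB map_degreeE.
(* Degrees multiply under composition, so both sides are the degree of f(A) = g(B). *)
- by rewrite -!natdeg_comp fg.
- exact: (@kernel_graph _ _ _ (A, B) P).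
Qed.
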